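(* Let $R$ be a Noetherian domain, and let $\mathrm{cl}$ be the closure operation $\mathrm{cl}_{\mathcal{A}}$ coming from a directed family $\mathcal{A}$ of torsion-free $R$-algebras. Suppose that an injective $R$-linear map $\alpha: R \to M$ sending $1 \mapsto u$, with $M$ a finitely generated $R$-module, is $\mathrm{cl}$-phantom. Then the map $\alpha': R \to \mathrm{Sym}^2(M)$ sending $1 \mapsto u \otimes u$ is also $\mathrm{cl}$-phantom. Hence $\mathrm{cl}$ satisfies the Algebra Axiom.
   Context: All rings are commutative with unity. The algebras in $\mathcal{A}$ are not assumed to be finitely generated (or Noetherian). Directed family of algebras: a family $\mathcal{A}$ of $R$-algebras such that for any $A, A' \in \mathcal{A}$ there is $B \in \mathcal{A}$ to which both $A$ and $A'$ map as $R$-algebras. The closure $\mathrm{cl}_{\mathcal{A}}$: for finitely generated $R$-modules $N \subseteq M$ and $u \in M$, $u \in N_M^{\mathrm{cl}_{\mathcal{A}}}$ if for some $A \in \mathcal{A}$, $1 \otimes u \in \mathrm{im}(A \otimes_R N \to A \otimes_R M)$. Phantom extension: let $\mathrm{cl}$ be a closure operation on $R$, $M$ a finitely generated $R$-module and $\alpha: R \to M$ an injective $R$-linear map with cokernel $Q$. Let $\epsilon \in \mathrm{Ext}^1_R(Q,R)$ correspond to $0 \to R \to M \to Q \to 0$. Then $\alpha$ is $\mathrm{cl}$-phantom if $\epsilon \in 0^{\mathrm{cl}}_{\mathrm{Ext}^1_R(Q,R)}$. Equivalently, if $P_\bullet$ is a projective resolution of $Q$ by finitely generated projectives and $\phi \in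 \mathrm{Hom}_R(P_1,R)$ is a cocycle representing $\epsilon$, then $\phi$ lies in the $\mathrm{cl}$-closure, in $\mathrm{Hom}_R(P_1,R)$, of the image of $\mathrm{Hom}_R(P_0,R) \to \mathrm{Hom}_R(P_1,R)$. Algebra Axiom for $\mathrm{cl}$: for every finitely generated $R$-module $M$, if $\alpha: R \to M$, $1 \mapsto e_1$, is $\mathrm{cl}$-phantom, then $\alpha': R \to \mathrm{Sym}^2(M)$, $1 \mapsto e_1 \otimes e_1$, is $\mathrm{cl}$-phantom. *)

(* Defs.v *)
From HB Require Import structures.
From mathcomp Require Import all_boot all_order all_algebra.
From mathcomp Require Import generic_quotient ring_quotient.
From mathcomp Require Import boolp functions.
From mathcomp.multinomials Require Import freeg.

Set Implicit Arguments.
Unset Strict Implicit.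
Unset Printing Implicit Defensive.

Import GRing.Theory.
Local Open Scope ring_scope.
Local Open Scope quotient_scope.

(* Modules over R are [lmodType R]; R itself, as a module, is [R^o].  Submodules
   are Prop-valued: no decidability is assumed. *)

Section Submodules.
Variables (R : comNzRingType) (V : lmodType R).

Record submodule := Submodule {
  smem :> V -> Prop;
  smem0 : smem 0;
  smemD : forall x y, smem x -> smem y -> smem (x + y);
  smemZ : forall (a : R) x, smem x -> smem (a *: x) }.

Section Span.
Variable X : V -> Prop.
Let spanp v := forall S : submodule, (forall x, X x -> S x) -> S v.
Fact span0 : spanp 0. Proof. by move=> S _; exact: smem0. Qed.
Fact spanD x y : spanp x -> spanp y -> spanp (x + y).
Proof. by move=> hx hy S XS; apply: smemD; [exact: hx|exact: hy]. Qed.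
Fact spanZ (a : R) x : spanp x -> spanp (a *: x).
Proof. by move=> hx S XS; apply: smemZ; exact: hx. Qed.
Definition submod_span : submodule := Submodule span0 spanD spanZ.

Lemma span_incl x : X x -> submod_span x.
Proof. by move=> Xx S; apply. Qed.
Lemma span_min (S : submodule) :
  (forall x, X x -> S x) -> forall v, submod_span v -> S v.
Proof. by move=> XS v; apply. Qed.
End Span.

Definition fg_submodule (S : submodule) : Prop :=
  exists s : seq V, forall v, S v <-> submod_span (fun x => x \in s) v.

Definition fg_module : Prop :=
  exists s : seq V, forall v, submod_span (fun x => x \in s) v.

Definition submod_pred (S : submodule) : {pred V} := fun v => `[< S v >].

Lemma submod_predP (S : submodule) v : reflect (S v) (v \in submod_pred S).
Proof. exact: asboolP. Qed.

Section Instances.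
Variable S : submodule.

Lemma submod_pred_closed : GRing.subsemimod_closed (submod_pred S).
Proof.
split=> [|a v /submod_predP Sv]; last exact/submod_predP/smemZ.
split=> [|x y /submod_predP Sx /submod_predP Sy].
  exact/submod_predP/smem0.
exact/submod_predP/smemD.
Qed.
HB.instance Definition _ :=
  GRing.isSubmodClosed.Build R V (submod_pred S) submod_pred_closed.

Record submod_sort := SubmodSort {
  submod_val :> V;
  submod_valP : submod_val \in submod_pred S }.
HB.instance Definition _ := [isSub for submod_val].
HB.instance Definition _ := [Choice of submod_sort by <:].
HB.instance Definition _ := [SubChoice_isSubLmodule of submod_sort by <:].

Definition quotmod := Quotient.quot (submod_pred S).
HB.instance Definition _ := GRing.Zmodule.on quotmod.

Definition quotmod_proj (v : V) : quotmod :=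
  \pi_(Quotient.quot (submod_pred S)) v.

Lemma quotmod_projP x y : quotmod_proj x = quotmod_proj y <-> S (x - y).
Proof.
split=> [/eqP|/submod_predP Sxy]; last first.
  by apply/eqP; rewrite -[_ == _]Quotient.idealrBE.
by rewrite -[_ == _]Quotient.idealrBE => /submod_predP.
Qed.

Lemma quotmod_proj_surj (q : quotmod) : exists v, quotmod_proj v = q.
Proof. by exists (repr q); rewrite /quotmod_proj reprK. Qed.

Lemma quotmod_projD x y :
  quotmod_proj (x + y) = quotmod_proj x + quotmod_proj y.
Proof. by rewrite /quotmod_proj !piE. Qed.

Definition quotmod_scale (a : R) (q : quotmod) : quotmod :=
  quotmod_proj (a *: repr q).

Lemma quotmod_scaleE a v :
  quotmod_scale a (quotmod_proj v) = quotmod_proj (a *: v).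
Proof.
apply/quotmod_projP; rewrite -scalerBr; apply: smemZ.
by apply/quotmod_projP; rewrite {1}/quotmod_proj reprK.
Qed.

Fact quotmod_scaleA a b q :
  quotmod_scale a (quotmod_scale b q) = quotmod_scale (a * b) q.
Proof.
by have [v <-] := quotmod_proj_surj q; rewrite !quotmod_scaleE scalerA.
Qed.
Fact quotmod_scale1 : left_id 1 quotmod_scale.
Proof.
by move=> q; have [v <-] := quotmod_proj_surj q; rewrite quotmod_scaleE scale1r.
Qed.
Fact quotmod_scaleDr : right_distributive quotmod_scale +%R.
Proof.
move=> a p q; have [v <-] := quotmod_proj_surj p.
have [w <-] := quotmod_proj_surj q.
by rewrite -quotmod_projD !quotmod_scaleE scalerDr quotmod_projD.
Qed.
Fact quotmod_scaleDl q : {morph quotmod_scale^~ q : a b / a + b}.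
Proof.
move=> a b; have [v <-] := quotmod_proj_surj q.
by rewrite !quotmod_scaleE scalerDl quotmod_projD.
Qed.
HB.instance Definition _ := GRing.Zmodule_isLmodule.Build R quotmod
  quotmod_scaleA quotmod_scale1 quotmod_scaleDr quotmod_scaleDl.

Fact quotmod_proj_linear : linear quotmod_proj.
Proof. by move=> a x y; rewrite quotmod_projD -quotmod_scaleE. Qed.
HB.instance Definition _ := GRing.isLinear.Build R V quotmod _ quotmod_proj
  quotmod_proj_linear.

End Instances.
End Submodules.

Arguments quotmod_proj {R V} S v.

Definition noetherian (R : comNzRingType) : Prop :=
  forall I : submodule R^o, fg_submodule I.

Section Maps.
Variables (R : comNzRingType) (U V : lmodType R) (f : {linear U -> V}).

Let imp v := exists u, f u = v.
Fact im0 : imp 0. Proof. by exists 0; rewrite linear0. Qed.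
Fact imD x y : imp x -> imp y -> imp (x + y).
Proof. by move=> [u <-] [v <-]; exists (u + v); rewrite linearD. Qed.
Fact imZ (a : R) x : imp x -> imp (a *: x).
Proof. by move=> [u <-]; exists (a *: u); rewrite linearZ. Qed.
Definition lin_im : submodule V := Submodule im0 imD imZ.

Definition coker := quotmod lin_im.
HB.instance Definition _ := GRing.Lmodule.on coker.

End Maps.

Definition projective (R : comNzRingType) (P : lmodType R) : Prop :=
  forall (M N : lmodType R) (g : {linear M -> N}) (h : {linear P -> N}),
    (forall y, exists x, g x = y) ->
    exists k : {linear P -> M}, forall p, g (k p) = h p.

(* V (x)_R W, as the free module on the pairs (v, w) modulo the bilinearity
   relations. *)
Section Tensor.
Variables (R : comNzRingType) (V W : lmodType R).

Let F := {freeg (V * W) / R}.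
Let fgen (v : V) (w : W) : F := << (v, w) >>.

Inductive bilinear_relator : F -> Prop :=
| RelDl v v' w : bilinear_relator (fgen (v + v') w - (fgen v w + fgen v' w))
| RelDr v w w' : bilinear_relator (fgen v (w + w') - (fgen v w + fgen v w'))
| RelZl a v w : bilinear_relator (fgen (a *: v) w - a *: fgen v w)
| RelZr a v w : bilinear_relator (fgen v (a *: w) - a *: fgen v w).

Definition tensor := quotmod (submod_span bilinear_relator).
HB.instance Definition _ := GRing.Lmodule.on tensor.

Definition pure_tensor (v : V) (w : W) : tensor :=
  quotmod_proj (submod_span bilinear_relator) (fgen v w).

Fact pure_tensorDl v v' w :
  pure_tensor (v + v') w = pure_tensor v w + pure_tensor v' w.
Proof.
by rewrite -linearD; apply/quotmod_projP/span_incl; exact: RelDl.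
Qed.

Fact pure_tensorDr v w w' :
  pure_tensor v (w + w') = pure_tensor v w + pure_tensor v w'.
Proof.
by rewrite -linearD; apply/quotmod_projP/span_incl; exact: RelDr.
Qed.

Fact pure_tensorZl a v w : pure_tensor (a *: v) w = a *: pure_tensor v w.
Proof.
by rewrite -linearZ; apply/quotmod_projP/span_incl; exact: RelZl.
Qed.

Fact pure_tensorZr a v w : pure_tensor v (a *: w) = a *: pure_tensor v w.
Proof.
by rewrite -linearZ; apply/quotmod_projP/span_incl; exact: RelZr.
Qed.

Section Lift.
Variables (P : lmodType R) (h : V -> W -> P).

(* Meaningful when h is bilinear, see [tensor_liftE]. *)
Definition tensor_lift (t : tensor) : P :=
  fglift (fun p : V * W => h p.1 p.2) (repr t).

Hypotheses (hl : forall w, linear (h^~ w)) (hr : forall v, linear (h v)).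

Let H : F -> P := fglift (fun p : V * W => h p.1 p.2).

Let H_linear : linear H.
Proof.
move=> a x y.
have HD u v : H (u + v) = H u + H v.
  have HB p q : H (p - q) = H p - H q by exact: lift_is_additive.
  have H0 : H 0 = 0 by rewrite -(subrr 0) HB subrr.
  by rewrite -[v in LHS]opprK HB -sub0r HB H0 sub0r opprK.
rewrite HD; congr (_ + _).
have Hsum (s : seq (V * W)) (c : V * W -> R) :
    H (\sum_(z <- s) << c z *g z >>) = \sum_(z <- s) c z *: h z.1 z.2.
  elim: s => [|z s IHs]; last by rewrite !big_cons HD IHs /H liftU.
  by rewrite !big_nil; apply: (addrI (H 0)); rewrite -HD !addr0.
have Hx : H x = \sum_(z <- dom x) coeff z x *: h z.1 z.2.
  by rewrite -{1}[x]freeg_sumE Hsum.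
rewrite Hx scaler_sumr; transitivity (H (fgscale a x)); first by [].
rewrite /fgscale Hsum.
by apply: eq_bigr => z _; rewrite scalerA.
Qed.

Let H_rel x : submod_span bilinear_relator x -> H x = 0.
Proof.
have HD u v : H (u + v) = H u + H v by rewrite -[u]scale1r H_linear !scale1r.
have H0 : H 0 = 0 by apply: (addrI (H 0)); rewrite -HD !addr0.
have HZ a u : H (a *: u) = a *: H u by rewrite -[a *: u]addr0 H_linear H0 addr0.
have HB u v : H (u - v) = H u - H v by rewrite HD -[- v]scaleN1r HZ scaleN1r.
have Hg v w : H (fgen v w) = h v w by rewrite /H liftU scale1r.
have kD u v : H u = 0 -> H v = 0 -> H (u + v) = 0.
  by move=> Hu Hv; rewrite HD Hu Hv addr0.
have kZ a u : H u = 0 -> H (a *: u) = 0 by move=> Hu; rewrite HZ Hu scaler0.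
apply: (span_min (S := @Submodule R F (fun y => H y = 0) H0 kD kZ)).
move=> _ [v v' w|v w w'|a v w|a v w] /=; rewrite HB ?HD ?HZ !Hg.
- by rewrite -[v]scale1r hl !scale1r subrr.
- by rewrite -[w]scale1r hr !scale1r subrr.
- have h0 : h 0 w = 0.
    have /= := hl w 1 0 0; rewrite scaler0 addr0 scale1r => e.
    by apply: (addrI (h 0 w)); rewrite -e addr0.
  by rewrite -[a *: v]addr0 hl h0 addr0 subrr.
- have h0 : h v 0 = 0.
    have := hr v 1 0 0; rewrite scaler0 addr0 scale1r => e.
    by apply: (addrI (h v 0)); rewrite -e addr0.
  by rewrite -[a *: w]addr0 hr h0 addr0 subrr.
Qed.

Let tensor_lift_proj x :
  tensor_lift (quotmod_proj (submod_span bilinear_relator) x) = H x.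
Proof.
rewrite /tensor_lift -/(H _); set y := repr _.
have /quotmod_projP/H_rel : quotmod_proj (submod_span bilinear_relator) y =
    quotmod_proj (submod_span bilinear_relator) x.
  by rewrite {1}/quotmod_proj reprK.
by rewrite addrC -scaleN1r H_linear scaleN1r addrC => /subr0_eq.
Qed.

Lemma tensor_liftE v w : tensor_lift (pure_tensor v w) = h v w.
Proof. by rewrite tensor_lift_proj /H liftU scale1r. Qed.

Lemma tensor_lift_linear : linear tensor_lift.
Proof.
move=> a s t; have [x <-] := quotmod_proj_surj s.
have [y <-] := quotmod_proj_surj t.
by rewrite -linearP !tensor_lift_proj H_linear.
Qed.

End Lift.
End Tensor.

Section TensorMap.
Variables (R : comNzRingType) (V W W' : lmodType R) (f : {linear W -> W'}).

Let h (v : V) (w : W) : tensor V W' := pure_tensor v (f w).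
Fact tensor_map_linear_l w : linear (h^~ w).
Proof. by move=> a v v'; rewrite /h pure_tensorDl pure_tensorZl. Qed.
Fact tensor_map_linear_r v : linear (h v).
Proof. by move=> a w w'; rewrite /h linearP pure_tensorDr pure_tensorZr. Qed.

(* The map id (x) f. *)
Definition tensor_map : tensor V W -> tensor V W' := tensor_lift h.

HB.instance Definition _ :=
  GRing.isLinear.Build R (tensor V W) (tensor V W') _ tensor_map
    (tensor_lift_linear tensor_map_linear_l tensor_map_linear_r).

Lemma tensor_mapE v w : tensor_map (pure_tensor v w) = pure_tensor v (f w).
Proof.
exact: tensor_liftE tensor_map_linear_l tensor_map_linear_r v w.
Qed.

End TensorMap.

Section Sym2.
Variables (R : comNzRingType) (M : lmodType R).

Inductive symmetry_relator : tensor M M -> Prop :=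
| RelSym x y : symmetry_relator (pure_tensor x y - pure_tensor y x).

Definition sym2 := quotmod (submod_span symmetry_relator).
HB.instance Definition _ := GRing.Lmodule.on sym2.

Definition sym2_mul (x y : M) : sym2 :=
  quotmod_proj (submod_span symmetry_relator) (pure_tensor x y).

End Sym2.

Section LinearMaps.
Variables (R : comNzRingType).

(* The R-linear map R -> V, 1 |-> v. *)
Definition scale_map (V : lmodType R) (v : V) (r : R^o) : V := (r : R) *: v.

Fact scale_map_linear (V : lmodType R) (v : V) : linear (scale_map v).
Proof. by move=> a x y; rewrite /scale_map scalerDl scalerA. Qed.
HB.instance Definition _ (V : lmodType R) (v : V) :=
  GRing.isLinear.Build R R^o V _ (scale_map v) (scale_map_linear v).

Definition alpha_sym2 (M : lmodType R) (alpha : {linear R^o -> M}) :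
    {linear R^o -> sym2 M} :=
  scale_map (sym2_mul (alpha 1) (alpha 1)).

Section Dual.
Variable P : lmodType R.

Let linp (f : P -> R^o) := linear f.
Fact dual0 : linp 0. Proof. by move=> a x y; rewrite scaler0 addr0. Qed.
Fact dualD f g : linp f -> linp g -> linp (f + g).
Proof.
by move=> hf hg a x y; rewrite !fctE hf hg scalerDr addrACA.
Qed.
Fact dualZ (a : R) f : linp f -> linp (a *: f).
Proof.
move=> hf b x y; rewrite !fctE hf scalerDr; congr (_ + _).
by rewrite !scalerA mulrC.
Qed.

(* Hom_R(P, R), a submodule of the module of all functions P -> R. *)
Definition dual_mod := submod_sort (Submodule dual0 dualD dualZ).
HB.instance Definition _ := GRing.Lmodule.on dual_mod.

Definition dual_fun (phi : dual_mod) : P -> R^o := submod_val phi.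

Lemma dual_fun_linear phi : linear (dual_fun phi).
Proof. by have /submod_predP := submod_valP phi. Qed.
HB.instance Definition _ phi :=
  GRing.isLinear.Build R P R^o _ (dual_fun phi) (dual_fun_linear phi).

Definition mk_dual (f : P -> R^o) (hf : linear f) : dual_mod :=
  SubmodSort (introT (submod_predP (Submodule dual0 dualD dualZ) f) hf).

End Dual.

Section DualMap.
Variables (P P' : lmodType R) (d : {linear P' -> P}).

Fact dual_map_subproof (psi : dual_mod P) : linear (dual_fun psi \o d).
Proof. by move=> a x y /=; rewrite !linearP. Qed.

Definition dual_map (psi : dual_mod P) : dual_mod P' :=
  mk_dual (dual_map_subproof psi).

Fact dual_map_linear : linear dual_map.
Proof. by move=> a x y; apply/val_inj/funext. Qed.
HB.instance Definition _ :=
  GRing.isLinear.Build R (dual_mod P) (dual_mod P') _ dual_map dual_map_linear.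

(* The image of Hom(P, R) -> Hom(P', R). *)
Definition coboundaries : submodule (dual_mod P') :=
  @lin_im R (dual_mod P) (dual_mod P') dual_map.

End DualMap.
End LinearMaps.

(* R-algebras, as rings with a structure morphism; unlike [comAlgType R], this
   does not exclude the zero algebra. *)
Record comAlgebra (R : comNzRingType) := ComAlgebra {
  alg_ring :> comPzRingType;
  alg_map : {rmorphism R -> alg_ring} }.

Section AlgebraAsModule.
Variables (R : comNzRingType) (A : comAlgebra R).

Definition alg_mod : Type := alg_ring A.
HB.instance Definition _ := GRing.ComPzRing.on alg_mod.

Definition alg_scale (r : R) (a : alg_mod) : alg_mod := alg_map A r * a.
Fact alg_scaleA r s a : alg_scale r (alg_scale s a) = alg_scale (r * s) a.
Proof. by rewrite /alg_scale rmorphM mulrA. Qed.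
Fact alg_scale1 : left_id 1 alg_scale.
Proof. by move=> a; rewrite /alg_scale rmorph1 mul1r. Qed.
Fact alg_scaleDr : right_distributive alg_scale +%R.
Proof. by move=> r a b; rewrite /alg_scale mulrDr. Qed.
Fact alg_scaleDl a : {morph alg_scale^~ a : r s / r + s}.
Proof. by move=> r s; rewrite /alg_scale rmorphD mulrDl. Qed.
HB.instance Definition _ := GRing.Zmodule_isLmodule.Build R alg_mod
  alg_scaleA alg_scale1 alg_scaleDr alg_scaleDl.

Definition torsion_free : Prop :=
  forall (r : R) (a : alg_mod), r *: a = 0 -> r = 0 \/ a = 0.

End AlgebraAsModule.

Definition alg_hom_exists (R : comNzRingType) (A B : comAlgebra R) : Prop :=
  exists f : {rmorphism alg_ring A -> alg_ring B},
    forall r, f (alg_map A r) = alg_map B r.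

Definition directed_family (R : comNzRingType) (AA : comAlgebra R -> Prop) :=
  forall A A', AA A -> AA A' ->
    exists B, [/\ AA B, alg_hom_exists A B & alg_hom_exists A' B].

(* A closure operation sends N <= M to a predicate on M.  It is only ever
   applied to finitely generated M. *)
Definition closure_operation (R : comNzRingType) :=
  forall M : lmodType R, submodule M -> M -> Prop.

Section Closure.
Variables (R : comNzRingType) (AA : comAlgebra R -> Prop).

Definition cl_family : closure_operation R := fun M N u =>
  exists2 A, AA A &
    exists z : tensor (alg_mod A) (submod_sort N),
      tensor_map val z = pure_tensor (1 : alg_mod A) u.

End Closure.

(* ... -> P 2 -> P 1 -> P 0 -> Q -> 0 *)
Record projective_resolution (R : comNzRingType) (Q : lmodType R) :=
  ProjectiveResolution {
  res_mod : nat -> lmodType R;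
  res_d : forall i, {linear res_mod i.+1 -> res_mod i};
  res_aug : {linear res_mod 0 -> Q};
  res_fg : forall i, fg_module (res_mod i);
  res_proj : forall i, projective (res_mod i);
  res_aug_surj : forall q, exists p, res_aug p = q;
  res_exact0 : forall p, res_aug p = 0 <-> exists p', res_d 0 p' = p;
  res_exact : forall i p, res_d i p = 0 <-> exists p', res_d i.+1 p' = p }.

Section Phantom.
Variables (R : comNzRingType) (cl : closure_operation R).
Variables (M : lmodType R) (alpha : {linear R^o -> M}).

(* phi : P_1 -> R represents the class in Ext^1(Q, R) of the extension
   0 -> R -> M -> Q -> 0, Q = coker alpha: there is a lifting of id_Q to a
   morphism of complexes
     P_1 --d--> P_0 --aug--> Q
      |phi       |lam        ||
      R --alpha-> M --------> Q
   (As alpha is injective, phi is then a cocycle.  The opposite sign convention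
   replaces phi by - phi, which does not affect [cl_phantom].) *)
Definition represents_extension (P : projective_resolution (coker alpha))
    (phi : dual_mod (res_mod P 1)) : Prop :=
  exists2 lam : {linear res_mod P 0 -> M},
    forall p, quotmod_proj (lin_im alpha) (lam p) = res_aug P p &
    forall p, alpha (dual_fun phi p) = lam (res_d P 0 p).

(* The class lies in the closure of 0 in the sense of cocycles: a representing
   cocycle lies in the closure of the coboundaries inside Hom(P_1, R).  Taking
   the closure of 0 inside the subquotient Ext^1(Q, R) instead would be stronger
   in general, as A (x) ker -> A (x) Hom(P_1, R) need not be injective. *)
Definition cl_phantom : Prop :=
  injective alpha /\
  forall (P : projective_resolution (coker alpha))
      (phi : dual_mod (res_mod P 1)),
    represents_extension phi ->
    cl (coboundaries (res_d P 0)) phi.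

End Phantom.

Definition algebra_axiom (R : comNzRingType) (cl : closure_operation R) :=
  forall (M : lmodType R) (alpha : {linear R^o -> M}),
    fg_module M -> cl_phantom cl alpha -> cl_phantom cl (alpha_sym2 alpha).

(* Main.v *)
From HB Require Import structures.
From mathcomp Require Import all_boot all_algebra.
From mathcomp Require Import boolp.
From mathcomp.multinomials Require Import freeg.
Require Import Defs.

Set Implicit Arguments.
Unset Strict Implicit.
Unset Printing Implicit Defensive.

Import GRing.Theory.
Local Open Scope ring_scope.

(** The idea is to read phantomness as a property of maps into algebras: over a
    Noetherian ring, an injective [alpha : R -> M] with [M] finitely generated
    is phantom for the closure given by a family of algebras if and only if
    some algebra [A] of the family receives an [R]-linear map [g : M -> A] with
    [g (alpha 1) = 1].

    From left to right ([phantom_to_algebra]), one chooses a resolution [P] of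
    [coker alpha] by finite free modules and a cocycle [phi].  That [1 (x) phi]
    comes from [A (x) coboundaries] gives, by evaluating the functionals, a
    linear map [Psi : P_0 -> A] with [Psi (d p) = phi p *: 1].  As [M] is the
    pushout of [P_0] and [R] along [d] and [phi], the map [Psi] and the
    structure map of [A] glue to [g] ([extension_pushout]).

    From right to left ([algebra_to_phantom]), given any resolution, [g]
    composed with the lifting [P_0 -> M] and expanded in a dual basis of [P_0]
    provides an element of [A (x) coboundaries].  It is mapped to [1 (x) phi]
    because an element of [A (x) Hom(P_1, R)] is determined by its evaluations
    on [P_1], which is finitely generated projective ([tensor_eval_inj]).

    If [g] sends [u = alpha 1] to [1], then the map [x * y |-> g x * g y] from
    [Sym^2 M] to [A] sends [u * u] to [1], so the same algebra works for
    [Sym^2 M].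

    It remains to see that [R -> Sym^2 M] is injective.  The algebra [A] may be
    zero, so this cannot be deduced from [g].  Instead, as [R] is a domain and
    [u] is not torsion, there is a functional [h : M -> R] with [h u != 0]
    ([torsion_free_functional]); then [x * y |-> h x * h y] sends [u * u] to a
    nonzero element of [R]. *)

(** * Linear maps and submodules *)

(** A function packed with a proof of its linearity. *)
Definition mk_linear (R : comNzRingType) (U V : lmodType R) (f : U -> V)
    (hf : linear f) : {linear U -> V} :=
  HB.pack f (GRing.isLinear.Build R U V _ f hf).

(** A linear map that kills the kernel of a surjection factors through it. *)
Lemma linear_factor_surj (R : comNzRingType) (U V W : lmodType R)
    (f : {linear U -> V}) (g : {linear U -> W}) :
    (forall v, exists u, f u = v) -> (forall u, f u = 0 -> g u = 0) ->
  exists h : {linear V -> W}, forall u, h (f u) = g u.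
Proof.
move=> /choice[s sK] kerfg.
have gs u : g (s (f u)) = g u.
  by apply/eqP; rewrite -subr_eq0 -linearB kerfg // linearB /= sK subrr.
have gs_lin : linear (g \o s).
  move=> a x y /=; rewrite -linearP -[RHS]gs; congr (g (s _)).
  by rewrite linearP /= !sK.
by exists (mk_linear gs_lin).
Qed.

(** A linear map with values in the image of an injection factors through it. *)
Lemma linear_factor_inj (R : comNzRingType) (U V W : lmodType R)
    (a : {linear V -> W}) (f : {linear U -> W}) :
    injective a -> (forall u, exists v, a v = f u) ->
  exists h : {linear U -> V}, forall u, a (h u) = f u.
Proof.
move=> a_inj /choice[s sK].
have s_lin : linear s.
  by move=> c x y; apply: a_inj; rewrite linearP /= !sK linearP.
by exists (mk_linear s_lin).
Qed.

Section Kernel.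
Variables (R : comNzRingType) (U V : lmodType R) (f : {linear U -> V}).
Fact lin_ker0 : f 0 = 0. Proof. exact: linear0. Qed.
Fact lin_kerD x y : f x = 0 -> f y = 0 -> f (x + y) = 0.
Proof. by rewrite linearD => -> ->; rewrite addr0. Qed.
Fact lin_kerZ (a : R) x : f x = 0 -> f (a *: x) = 0.
Proof. by move=> fx0; rewrite linearZ /= fx0 scaler0. Qed.
(** The kernel of [f]. *)
Definition lin_ker : submodule U :=
  @Submodule R U (fun x => f x = 0) lin_ker0 lin_kerD lin_kerZ.
End Kernel.

(** A submodule of a tensor product containing the pure tensors is the
    whole of it. *)
Lemma tensor_ind (R : comNzRingType) (V W : lmodType R)
    (T : submodule (tensor V W)) :
  (forall v w, T (pure_tensor v w)) -> forall z, T z.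
Proof.
move=> Tpure z; have [x <-] := quotmod_proj_surj z.
rewrite -[x]freeg_sumE linear_sum; elim/big_ind: _ => [||[v w] _].
- exact: smem0.
- by move=> ? ?; exact: smemD.
have -> : << coeff (v, w) x *g (v, w) >> =
    coeff (v, w) x *: << (v, w) >> :> {freeg (V * W) / R}.
  by apply/eqP/freeg_eqP => k; rewrite coeffZ !coeffU mul1r.
by rewrite linearZ; apply: smemZ; exact: Tpure.
Qed.

Lemma tensor_linear_ext (R : comNzRingType) (V W U : lmodType R)
    (f g : {linear tensor V W -> U}) :
  (forall v w, f (pure_tensor v w) = g (pure_tensor v w)) -> f =1 g.
Proof.
move=> fg z; apply: subr0_eq.
by apply: (tensor_ind (T := lin_ker (f \- g))) => v w /=; rewrite fg subrr.
Qed.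

Section Combination.
Variables (R : comNzRingType) (V : lmodType R) (n : nat) (e : 'I_n -> V).
Fact lincomb_linear : linear (fun v : 'rV[R]_n => \sum_i v 0 i *: e i).
Proof.
move=> a x y; rewrite scaler_sumr -big_split; apply: eq_bigr => i _.
by rewrite !mxE scalerDl scalerA.
Qed.

(** The map from R^n to [V] that sends the [i]-th basis vector to [e i]. *)
Definition lincomb : {linear 'rV[R]_n -> V} := mk_linear lincomb_linear.

Lemma lincomb_delta i : lincomb (delta_mx 0 i) = e i.
Proof.
rewrite /= (bigD1 i) //= mxE !eqxx scale1r big1 ?addr0 // => j /negPf ji.
by rewrite mxE ji andbF scale0r.
Qed.

Lemma lincomb_mem (S : submodule V) a : (forall i, S (e i)) -> S (lincomb a).
Proof.
move=> Se; rewrite /=; elim/big_ind: _ => [||i _]; first exact: smem0.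
  by move=> ? ?; exact: smemD.
exact: smemZ.
Qed.

End Combination.

Lemma linear_lincomb (R : comNzRingType) (V W : lmodType R) (n : nat)
    (f : {linear V -> W}) (e : 'I_n -> V) v :
  f (lincomb e v) = lincomb (f \o e) v.
Proof. by rewrite /= linear_sum; apply: eq_bigr => i _; rewrite linearZ. Qed.

Lemma lincomb_id (R : comNzRingType) (n : nat) (v : 'rV[R]_n) :
  lincomb (fun i => delta_mx 0 i) v = v.
Proof. by rewrite /= -row_sum_delta. Qed.

Lemma submod_spanP (R : comNzRingType) (V : lmodType R) (s : seq V) v :
  submod_span (fun x => x \in s) v <->
  exists a, lincomb (fun i : 'I_(size s) => s`_i) a = v.
Proof.
split=> [|[a <-]]; last first.
  by apply: lincomb_mem => i; apply: span_incl; exact: mem_nth.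
move/(_ (lin_im (lincomb (fun i : 'I_(size s) => s`_i)))); apply => x xs.
have si : (index x s < size s)%N by rewrite index_mem.
by exists (delta_mx 0 (Ordinal si)); rewrite lincomb_delta /= nth_index.
Qed.

Section ImagePreimage.
Variables (R : comNzRingType) (V W : lmodType R) (f : {linear V -> W}).

Section Image.
Variable S : submodule V.
Let imp w := exists2 v, S v & f v = w.
Fact submod_im0 : imp 0.
Proof. by exists 0; [exact: smem0 | rewrite linear0]. Qed.
Fact submod_imD x y : imp x -> imp y -> imp (x + y).
Proof.
move=> [v Sv <-] [v' Sv' <-].
by exists (v + v'); [exact: smemD | rewrite linearD].
Qed.
Fact submod_imZ (a : R) x : imp x -> imp (a *: x).
Proof.
by move=> [v Sv <-]; exists (a *: v); [exact: smemZ | rewrite linearZ].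
Qed.
(** The image of the submodule [S] under [f]. *)
Definition submod_im : submodule W :=
  Submodule submod_im0 submod_imD submod_imZ.

End Image.

Section Preimage.
Variable S : submodule W.
Fact submod_preim0 : S (f 0). Proof. by rewrite linear0; exact: smem0. Qed.
Fact submod_preimD x y : S (f x) -> S (f y) -> S (f (x + y)).
Proof. by rewrite linearD; exact: smemD. Qed.
Fact submod_preimZ (a : R) x : S (f x) -> S (f (a *: x)).
Proof. by rewrite linearZ; exact: smemZ. Qed.
(** The preimage of the submodule [S] under [f]. *)
Definition submod_preim : submodule V :=
  @Submodule R V (fun v => S (f v)) submod_preim0 submod_preimD submod_preimZ.

End Preimage.

Lemma submod_span_map (s : seq V) w :
  submod_span (fun x => x \in map f s) w <->
  submod_im (submod_span (fun x => x \in s)) w.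
Proof.
split=> [|[v + <-]].
  apply: span_min => _ /mapP[v sv ->].
  by exists v => //; exact: span_incl.
apply: (span_min (S := submod_preim (submod_span _))) => x xs /=.
by apply: span_incl; exact: map_f.
Qed.

End ImagePreimage.

(** * Free resolutions over a Noetherian ring *)

(** All submodules of [V] are finitely generated. *)
Definition noetherian_module (R : comNzRingType) (V : lmodType R) : Prop :=
  forall S : submodule V, fg_submodule S.

(** If W and V are Noetherian, then so is the middle term of W -> U -> V,
    provided that the kernel of U -> V is contained in the image of W -> U. *)
Lemma noetherian_extension (R : comNzRingType) (W U V : lmodType R)
    (k : {linear W -> U}) (f : {linear U -> V}) :
    (forall u, f u = 0 -> exists w, k w = u) ->
    noetherian_module W -> noetherian_module V -> noetherian_module U.
Proof.
move=> exact_kf noethW noethV S.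
have [sV sVP] := noethV (submod_im f S).
have [sW sWP] := noethW (submod_preim k S).
(* t lifts the generators of the image of S to elements of S. *)
have [t tS tV] : exists2 t : seq U, (forall x, x \in t -> S x) & map f t = sV.
  have: forall y, y \in sV -> submod_im f S y.
    by move=> y ysV; apply/sVP; exact: span_incl.
  elim: (sV) => [|y s IHs] sS; first by exists [::].
  have [|t tS <-] := IHs; first by move=> x xs; apply: sS; rewrite inE xs orbT.
  have [x Sx <-] := sS y (mem_head _ _).
  by exists (x :: t) => // z; rewrite inE => /orP[/eqP->|/tS].
exists (t ++ map k sW) => x; split=> [Sx|]; last first.
  apply: span_min => y; rewrite mem_cat => /orP[/tS //|/mapP[w ws ->]].
  by apply/(sWP w); exact: span_incl.
have /sVP : submod_im f S (f x) by exists x.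
rewrite -tV => /submod_span_map[y yt fyx].
have Sy : S y by exact: span_min yt.
have [w kw] : exists w, k w = x - y.
  by apply: exact_kf; rewrite linearB /= fyx subrr.
have /sWP ws : submod_preim k S w.
  by rewrite /= kw -scaleN1r; apply: smemD => //; exact: smemZ.
have -> : x = y + k w by rewrite kw addrC subrK.
apply: smemD.
  by apply: span_min yt => z zt; apply: span_incl; rewrite mem_cat zt.
have : submod_span (fun x => x \in map k sW) (k w).
  by apply/submod_span_map; exists w.
by apply: span_min => z zk; apply: span_incl; rewrite mem_cat zk orbT.
Qed.

Lemma noetherian_rV (R : comNzRingType) n :
  noetherian R -> noetherian_module 'rV[R]_n.
Proof.
move=> noethR; elim: n => [|n IHn]; last rewrite -[n.+1]/(1 + n)%N.
  move=> S; exists [::] => v; rewrite (thinmx0 v).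
  by split=> _; exact: smem0.
(* Split off the first coordinate: 0 -> R^n -> R^(1 + n) -> R. *)
have k_lin : linear (fun w : 'rV[R]_n => row_mx (0 : 'rV_1) w : 'rV_(1 + n)).
  by move=> a x y; rewrite scale_row_mx add_row_mx scaler0 addr0.
have f_lin : linear (fun v : 'rV[R]_(1 + n) => v 0 0 : R^o).
  by move=> a x y; rewrite !mxE.
apply: (noetherian_extension (k := mk_linear k_lin)
  (f := mk_linear f_lin)) => //= v.
move=> v0; exists (rsubmx v); rewrite /= -[RHS]hsubmxK.
congr row_mx; apply/rowP=> i; rewrite !mxE ord1 -[LHS]v0; congr (v 0 _).
exact/val_inj.
Qed.

Lemma kernel_cover (R : comNzRingType) (n : nat) (V : lmodType R)
    (f : {linear 'rV[R]_n -> V}) :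
  noetherian R ->
  exists m (g : {linear 'rV[R]_m -> 'rV[R]_n}),
    forall v, f v = 0 <-> exists w, g w = v.
Proof.
move=> noethR.
have [s sP] := noetherian_rV noethR (lin_ker f).
exists (size s), (lincomb (fun i : 'I_(size s) => s`_i)) => v.
by rewrite -submod_spanP -sP.
Qed.

Lemma projective_rV (R : comNzRingType) n : projective 'rV[R]_n.
Proof.
move=> M N g h /choice[s sK].
exists (lincomb (fun i => s (h (delta_mx 0 i)))) => p.
rewrite linear_lincomb -{2}[p]lincomb_id linear_lincomb /=.
by apply: eq_bigr => i _; rewrite sK.
Qed.

Lemma fg_rV (R : comNzRingType) n : fg_module 'rV[R]_n.
Proof.
exists [seq delta_mx 0 i | i <- enum 'I_n] => v.
rewrite -[v]lincomb_id; apply: lincomb_mem => i; apply: span_incl.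
by apply: map_f; rewrite mem_enum.
Qed.

Lemma fg_cover (R : comNzRingType) (V : lmodType R) :
  fg_module V ->
  exists n (f : {linear 'rV[R]_n -> V}), forall v, exists w, f w = v.
Proof.
move=> [s sP]; exists (size s), (lincomb (fun i : 'I_(size s) => s`_i)) => v.
exact/submod_spanP.
Qed.

Section FreeResolution.
Variables (R : comNzRingType) (noethR : noetherian R).

(** A linear map between finite free modules. *)
Record free_map := FreeMap {
  fm_src : nat;
  fm_tgt : nat;
  fm_fun : {linear 'rV[R]_fm_src -> 'rV[R]_fm_tgt} }.

(** A map from a finite free module onto the kernel of [D].  Its target is the
    source of [D] by computation, so that the iterates of [next_free_map] are
    composable without casts. *)
Definition next_free_map (D : free_map) : free_map :=
  let m := cid (kernel_cover (fm_fun D) noethR) in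
  FreeMap (sval (cid (svalP m))).

Lemma next_free_mapP (D : free_map) v :
  fm_fun D v = 0 <-> exists w, fm_fun (next_free_map D) w = v.
Proof.
exact: (svalP (cid (svalP (cid (kernel_cover (fm_fun D) noethR))))) v.
Qed.

Lemma projective_resolution_exists (Q : lmodType R) :
  fg_module Q -> inhabited (projective_resolution Q).
Proof.
move=> /fg_cover[n0 [aug aug_surj]].
have [m0 [d0 d0P]] := kernel_cover aug noethR.
pose D i := iter i next_free_map (FreeMap d0).
pose P i : lmodType R := 'rV[R]_(fm_tgt (D i)).
pose d i : {linear P i.+1 -> P i} := fm_fun (D i).
apply: inhabits; apply: (@ProjectiveResolution R Q P d aug) => //.
- by move=> i; exact: fg_rV.
- by move=> i; exact: projective_rV.
- by move=> i p; exact: next_free_mapP.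
Qed.

End FreeResolution.

(** * Tensor products with the dual of a projective module *)

Section TensorEval.
Variables (R : comNzRingType) (A : comAlgebra R) (P : lmodType R) (p : P).

Let ev (a : alg_mod A) (psi : dual_mod P) : alg_mod A :=
  (dual_fun psi p : R) *: a.
Fact tensor_eval_linear_l psi : linear (ev^~ psi).
Proof. by move=> c x y; rewrite /ev scalerDr !scalerA mulrC. Qed.
Fact tensor_eval_linear_r a : linear (ev a).
Proof. by move=> c x y; rewrite /ev scalerA -scalerDl. Qed.

(** Evaluation at [p]: the map A (x) Hom(P, R) -> A, a (x) psi |-> psi(p) a. *)
Definition tensor_eval : tensor (alg_mod A) (dual_mod P) -> alg_mod A :=
  tensor_lift ev.

HB.instance Definition _ :=
  GRing.isLinear.Build R (tensor (alg_mod A) (dual_mod P)) (alg_mod A) _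
    tensor_eval (tensor_lift_linear tensor_eval_linear_l tensor_eval_linear_r).

Lemma tensor_evalE a psi :
  tensor_eval (pure_tensor a psi) = (dual_fun psi p : R) *: a.
Proof.
exact: (tensor_liftE tensor_eval_linear_l tensor_eval_linear_r).
Qed.

End TensorEval.

Lemma dual_mod_inj (R : comNzRingType) (P : lmodType R) (f g : dual_mod P) :
  dual_fun f =1 dual_fun g -> f = g.
Proof. by move=> fg; apply/val_inj/funext. Qed.

(** The dual basis lemma for finitely generated projective modules. *)
Lemma dual_basis (R : comNzRingType) (P : lmodType R) :
    fg_module P -> projective P ->
  exists n (e : 'I_n -> P) (theta : 'I_n -> dual_mod P),
    forall p, p = \sum_i (dual_fun (theta i) p : R) *: e i.
Proof.
move=> /fg_cover[n [f f_surj]] projP.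
have id_lin : linear (@id P) by [].
have [k kK] := projP _ _ f (mk_linear id_lin) f_surj.
have th_lin i : linear (fun p => k p 0 i : R^o).
  by move=> a x y /=; rewrite linearP !mxE.
exists n, (fun i => f (delta_mx 0 i)), (fun i => mk_dual (th_lin i)) => p.
by rewrite -[LHS]kK -[k p]lincomb_id linear_lincomb.
Qed.

(** The map A (x) Hom(P, R) -> Hom(P, A) is injective when [P] is finitely
    generated projective. *)
Lemma tensor_eval_inj (R : comNzRingType) (A : comAlgebra R) (P : lmodType R) :
    fg_module P -> projective P ->
    forall s t : tensor (alg_mod A) (dual_mod P),
  (forall p, tensor_eval p s = tensor_eval p t) -> s = t.
Proof.
move=> fgP projP; have [n [e [theta pE]]] := dual_basis fgP projP.
(* The inverse of A (x) Hom(P, R) -> Hom(P, A) given by the dual basis. *)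
pose E (t : tensor (alg_mod A) (dual_mod P)) :=
  \sum_i pure_tensor (tensor_eval (e i) t) (theta i).
have E_lin : linear E.
  move=> a x y; rewrite /E scaler_sumr -big_split; apply: eq_bigr => i _ /=.
  by rewrite linearP pure_tensorDl pure_tensorZl.
have EK t : E t = t.
  have id_lin : linear (@id (tensor (alg_mod A) (dual_mod P))) by [].
  apply: (tensor_linear_ext (f := mk_linear E_lin) (g := mk_linear id_lin)).
  move=> a psi; rewrite [LHS]/(E _) [RHS]/(pure_tensor _ _).
  have psiE : psi = \sum_i (dual_fun psi (e i) : R) *: theta i.
    apply: dual_mod_inj => p.
    (* Functionals are compared at each p, through evaluation at p, which is
       linear in the functional. *)
    pose evp (f : dual_mod P) := dual_fun f p.
    have evp_lin : linear evp by [].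
    rewrite -[RHS]/(mk_linear evp_lin _) linear_sum /= {1}[p]pE linear_sum.
    by apply: eq_bigr => i _; rewrite linearZ; exact: mulrC.
  rewrite {2}psiE /E.
  have pt_lin : linear (@pure_tensor R (alg_mod A) (dual_mod P) a).
    by move=> c x y; rewrite pure_tensorDr pure_tensorZr.
  rewrite -[RHS]/(mk_linear pt_lin _) linear_sum /=; apply: eq_bigr => i _.
  by rewrite tensor_evalE pure_tensorZr pure_tensorZl.
move=> s t st; rewrite -[s]EK -[t]EK /E.
by apply: eq_bigr => i _; rewrite st.
Qed.

Lemma fg_quotmod (R : comNzRingType) (V : lmodType R) (S : submodule V) :
  fg_module V -> fg_module (quotmod S).
Proof.
move=> [s sP]; exists (map (quotmod_proj S) s) => q.
have [v <-] := quotmod_proj_surj q.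
by apply/submod_span_map; exists v.
Qed.

(** * The extension attached to a cocycle *)

Section Pushout.
Variables (R : comNzRingType) (M : lmodType R) (alpha : {linear R^o -> M}).

Lemma extension_cocycle_exists (P : projective_resolution (coker alpha)) :
  injective alpha ->
  exists phi : dual_mod (res_mod P 1), represents_extension phi.
Proof.
move=> alpha_inj.
pose pr : {linear M -> coker alpha} := quotmod_proj (lin_im alpha).
(* The lifting lam comes from the projectivity of P_0; lam \o d has values in
   the image of alpha, as it vanishes in the cokernel. *)
have [lam lamE] := @res_proj _ _ P 0 _ _ pr (res_aug P)
  (@quotmod_proj_surj _ _ _).
have ld_lin : linear (lam \o res_d P 0) by move=> a x y /=; rewrite !linearP.
have [|phi phiE] :=
    @linear_factor_inj _ _ _ _ alpha (mk_linear ld_lin) alpha_inj.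
  move=> p /=; suff : lin_im alpha (lam (res_d P 0 p)) by [].
  rewrite -[lam _]subr0; apply/quotmod_projP; rewrite lamE linear0.
  by apply/res_exact0; exists p.
by exists (mk_dual (linearP phi)), lam.
Qed.

(** [M] has the universal property of the pushout of P_0 <-d- P_1 -phi-> R. *)
Lemma extension_pushout (P : projective_resolution (coker alpha))
    (phi : dual_mod (res_mod P 1)) (lam : {linear res_mod P 0 -> M})
    (W : lmodType R) (Psi : {linear res_mod P 0 -> W}) (w : W) :
    injective alpha ->
    (forall p, quotmod_proj (lin_im alpha) (lam p) = res_aug P p) ->
    (forall p, alpha (dual_fun phi p) = lam (res_d P 0 p)) ->
    (forall p, Psi (res_d P 0 p) = (dual_fun phi p : R) *: w) ->
  exists2 g : {linear M -> W}, forall p, g (lam p) = Psi p & g (alpha 1) = w.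
Proof.
move=> alpha_inj lamE phiE PsiE.
(* The map P_0 + R -> M is onto, and its kernel consists of the pairs
   (d p', - phi p'). *)
pose U : lmodType R := (res_mod P 0 * R^o)%type.
have f_lin : linear (fun x : U => lam x.1 + alpha x.2).
  by move=> a x y /=; rewrite !linearP scalerDr addrACA.
have h_lin : linear (fun x : U => Psi x.1 + (x.2 : R) *: w).
  by move=> a x y /=; rewrite linearP scalerDl -scalerA scalerDr addrACA.
have [||g gE] :=
    linear_factor_surj (f := mk_linear f_lin) (g := mk_linear h_lin).
- move=> m.
  have [p pm] := res_aug_surj P (quotmod_proj (lin_im alpha) m).
  have [r rE] : lin_im alpha (m - lam p) by apply/quotmod_projP; rewrite lamE.
  by exists (p, r); rewrite /= rE addrC subrK.
- move=> [p r] /= pr0.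
  have lamp : lam p = alpha (- r).
    by rewrite linearN; apply/eqP; rewrite -addr_eq0 pr0.
  have [p' p'E] : exists p', res_d P 0 p' = p.
    apply/res_exact0; rewrite -lamE -(linear0 (quotmod_proj (lin_im alpha))).
    by apply/quotmod_projP; rewrite subr0; exists (- r).
  move: lamp; rewrite -p'E -phiE => /alpha_inj phip'.
  by rewrite PsiE phip' -scalerDl addNr scale0r.
exists g.
  by move=> p; have := gE (p, 0); rewrite /= linear0 scale0r !addr0.
by have := gE (0, 1); rewrite /= !linear0 scale1r !add0r.
Qed.

End Pushout.

(** * Phantom maps and maps into algebras *)

(** Evaluating an element of A (x) coboundaries on P' gives a map P' -> A that
    factors through [d : P' -> P]. *)
Lemma coboundary_tensor_eval (R : comNzRingType) (A : comAlgebra R)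
    (P P' : lmodType R) (d : {linear P' -> P})
    (t : tensor (alg_mod A) (submod_sort (coboundaries d))) :
  exists Psi : {linear P -> alg_mod A},
    forall p, Psi (d p) = tensor_eval p (tensor_map val t).
Proof.
pose T (t : tensor (alg_mod A) (submod_sort (coboundaries d))) :=
  exists Psi : {linear P -> alg_mod A},
    forall p, Psi (d p) = tensor_eval p (tensor_map val t).
have T0 : T 0 by exists \0 => p; rewrite 2!linear0.
have TD x y : T x -> T y -> T (x + y).
  move=> [F Fx] [G Gy]; exists (F \+ G) => p.
  by rewrite [LHS]/(F _ + G _) Fx Gy 2!linearD.
have TZ (a : R) x : T x -> T (a *: x).
  move=> [F Fx]; exists (a \*: F) => p.
  by rewrite [LHS]/(a *: F _) Fx 2!linearZ.
apply: (tensor_ind (T := Submodule T0 TD TZ)) => a b.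
have /submod_predP[psi psiE] := submod_valP b.
have F_lin : linear (fun p => (dual_fun psi p : R) *: a).
  by move=> c x y /=; rewrite linearP scalerDl scalerA.
by exists (mk_linear F_lin) => p; rewrite tensor_mapE tensor_evalE /= -psiE.
Qed.

Section Criterion.
Variables (R : comNzRingType) (AA : comAlgebra R -> Prop).
Variables (M : lmodType R) (alpha : {linear R^o -> M}).

Lemma phantom_to_algebra :
    noetherian R -> fg_module M -> cl_phantom (cl_family AA) alpha ->
  exists2 A, AA A & exists g : {linear M -> alg_mod A}, g (alpha 1) = 1.
Proof.
move=> noethR fgM [alpha_inj phantom].
have [P] := projective_resolution_exists noethR (fg_quotmod (lin_im alpha) fgM).
have [phi phi_rep] := @extension_cocycle_exists _ _ alpha P alpha_inj.
have [A AA_A [z zE]] := phantom P phi phi_rep.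
exists A => //; have [lam lamE phiE] := phi_rep.
have [Psi PsiE] := coboundary_tensor_eval z.
have [|g _ g1] :=
    @extension_pushout _ _ alpha P phi lam _ Psi 1 alpha_inj lamE phiE.
  by move=> p; rewrite PsiE zE tensor_evalE.
by exists g.
Qed.

Lemma algebra_to_phantom (A : comAlgebra R) (g : {linear M -> alg_mod A}) :
    injective alpha -> AA A -> g (alpha 1) = 1 ->
  cl_phantom (cl_family AA) alpha.
Proof.
move=> alpha_inj AA_A g1; split=> // P phi [lam lamE phiE].
exists A => //.
have [n [e [theta pE]]] := dual_basis (@res_fg _ _ P 0) (@res_proj _ _ P 0).
have cob i : dual_map (res_d P 0) (theta i) \in
    submod_pred (coboundaries (res_d P 0)).
  by apply/submod_predP; exists (theta i).
exists (\sum_i pure_tensor (g (lam (e i))) (SubmodSort (cob i))).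
apply: (tensor_eval_inj (@res_fg _ _ P 1) (@res_proj _ _ P 1)) => p.
have galpha r : g (alpha r) = (r : R) *: (1 : alg_mod A).
  by rewrite -g1 -linearZ -linearZ /= /GRing.scale /= mulr1.
rewrite tensor_evalE -galpha phiE {1}[res_d P 0 p]pE !linear_sum /=.
by apply: eq_bigr => i _; rewrite tensor_mapE tensor_evalE !linearZ.
Qed.

End Criterion.

(** * Maps out of the symmetric square *)

Section Sym2Lift.
Variables (R : comNzRingType) (M W : lmodType R) (h : M -> M -> W).
Hypotheses (h_linear_l : forall y, linear (h^~ y)).
Hypotheses (h_linear_r : forall x, linear (h x)).
Hypothesis h_sym : forall x y, h x y = h y x.

Lemma sym2_lift_exists :
  exists H : {linear sym2 M -> W}, forall x y, H (sym2_mul x y) = h x y.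
Proof.
pose S : submodule (tensor M M) := submod_span (@symmetry_relator R M).
pose f := mk_linear (tensor_lift_linear h_linear_l h_linear_r).
have fE x y : f (pure_tensor x y) = h x y.
  exact: (tensor_liftE h_linear_l h_linear_r).
pose pr : {linear tensor M M -> quotmod S} := quotmod_proj S.
have [||H HE] := @linear_factor_surj R _ _ _ pr f.
- exact: quotmod_proj_surj.
- move=> u pru; have Su : S u.
    by rewrite -[u]subr0; apply/quotmod_projP; rewrite [LHS]pru -(linear0 pr).
  apply: (span_min (S := lin_ker f)) Su => _ [x y].
  suff : f (pure_tensor x y - pure_tensor y x) = 0 by [].
  by rewrite linearB !fE h_sym subrr.
by exists H => x y; rewrite -fE -HE.
Qed.

End Sym2Lift.

(** * Injectivity into the symmetric square *)

(** If [e 0] is not torsion, scalars [c i] with [c 0 != 0] can be chosen so that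
    they satisfy every linear relation between [e 0], ..., [e n]. *)
Lemma functional_on_generators (R : idomainType) (M : lmodType R)
    (e : nat -> M) :
    (forall a : R, a *: e 0%N = 0 -> a = 0) ->
  forall n, exists2 c : nat -> R, c 0%N != 0 & forall a : nat -> R,
    \sum_(i < n.+1) a i *: e i = 0 -> \sum_(i < n.+1) a i * c i = 0.
Proof.
move=> e0_free; elim=> [|n [c c0 cP]].
  exists (fun=> 1) => [|a]; first exact: oner_neq0.
  by rewrite !big_ord1 mulr1; exact: e0_free.
(* If e_(n+1) occurs in no relation, its value is irrelevant. *)
have [[b b_rel bn]|no_rel] := pselect (exists2 b : nat -> R,
    \sum_(i < n.+2) b i *: e i = 0 & b n.+1 != 0); last first.
  exists (fun i => if (i < n.+1)%N then c i else 0) => // a.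
  move=> a_rel; have an : a n.+1 = 0.
    by apply/eqP; apply/negPn/negP => an; apply: no_rel; exists a.
  rewrite big_ord_recr /= an mul0r addr0 -[RHS](cP a).
    by apply: eq_bigr => i _; rewrite /= ltn_ord.
  by move: a_rel; rewrite big_ord_recr /= an scale0r addr0.
(* Given a relation b with b_(n+1) nonzero, rescale c by b_(n+1) and let b
   determine the last value.  Any relation a becomes one between the first
   n + 1 elements after multiplying by b_(n+1) and subtracting a_(n+1) b. *)
pose s := \sum_(i < n.+1) b i * c i.
exists (fun i => if (i < n.+1)%N then b n.+1 * c i else - s).
  by rewrite /= mulf_neq0.
move=> a a_rel.
have := cP (fun i => b n.+1 * a i - a n.+1 * b i).
have -> : \sum_(i < n.+1) (b n.+1 * a i - a n.+1 * b i) *: e i = 0.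
  under eq_bigr => i _ do rewrite scalerBl -!scalerA.
  rewrite sumrB -!scaler_sumr.
  move: a_rel b_rel; rewrite !(big_ord_recr n.+1) /= => /eqP + /eqP.
  rewrite !addr_eq0 => /eqP-> /eqP->.
  by rewrite !scalerN !scalerA mulrC opprK addNr.
move/(_ erefl) => ca0; rewrite -[RHS]ca0 big_ord_recr /=.
rewrite ltnn mulrN mulr_sumr.
rewrite -sumrB; apply: eq_bigr => i _.
by rewrite ltn_ord mulrBl !mulrA [a i * _]mulrC.
Qed.

Lemma torsion_free_functional (R : idomainType) (M : lmodType R) (u : M) :
    fg_module M -> (forall a : R, a *: u = 0 -> a = 0) ->
  exists h : {linear M -> R^o}, h u != 0.
Proof.
move=> [s sP] u_free.
pose e i := (u :: s)`_i.
have [c c0 cP] := functional_on_generators (e := e) u_free (size s).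
pose f := lincomb (fun i : 'I_(size s).+1 => e i).
pose g := lincomb (fun i : 'I_(size s).+1 => c i : R^o).
have [||h hE] := @linear_factor_surj R _ _ _ f g.
- move=> v; apply/(submod_spanP (u :: s)).
  by apply: span_min (sP v) => x xs; apply: span_incl; rewrite inE xs orbT.
- move=> a fa0; pose a' i := a 0 (inord i).
  have a'E (i : 'I_(size s).+1) : a' i = a 0 i by rewrite /a' inord_val.
  have := cP a'; under eq_bigr => i _ do rewrite a'E.
  by move=> /(_ fa0) ga0; rewrite -[RHS]ga0; apply: eq_bigr => i _; rewrite a'E.
exists h; have := hE (delta_mx 0 ord0).
by rewrite !lincomb_delta => ->.
Qed.

Lemma alpha_sym2_inj (R : idomainType) (M : lmodType R)
    (alpha : {linear R^o -> M}) :
  fg_module M -> injective alpha -> injective (alpha_sym2 alpha).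
Proof.
move=> fgM alpha_inj.
have [a au0|h hu] := torsion_free_functional fgM (u := alpha 1).
  apply: alpha_inj; rewrite linear0 -au0 -linearZ; congr (alpha _).
  by rewrite [RHS]mulr1.
have hl y : linear (fun x => h x * h y : R^o).
  by move=> a x x'; rewrite linearP mulrDl scalerAl.
have hr x : linear (fun y => h x * h y : R^o).
  by move=> a y y'; rewrite linearP mulrDr scalerAr.
have [H HE] := sym2_lift_exists hl hr (fun x y => mulrC (h x) (h y)).
have HalphaE r : H (alpha_sym2 alpha r) = (r : R) * (h (alpha 1) * h (alpha 1)).
  have -> : alpha_sym2 alpha r = (r : R) *: sym2_mul (alpha 1) (alpha 1) by [].
  by rewrite linearZ HE.
have hh0 : h (alpha 1) * h (alpha 1) != 0 by rewrite mulf_neq0.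
move=> a b ab; apply: (mulIf hh0).
by rewrite -(HalphaE a) -(HalphaE b) ab.
Qed.

Theorem proposition3p11 (R : idomainType) (noethR : noetherian R)
    (AA : comAlgebra R -> Prop) (dirAA : directed_family AA)
    (tfAA : forall A : comAlgebra R, AA A -> torsion_free A) :
  (forall (M : lmodType R) (alpha : {linear R^o -> M}),
      fg_module M -> injective alpha -> cl_phantom (cl_family AA) alpha ->
      cl_phantom (cl_family AA) (alpha_sym2 alpha)) /\
  algebra_axiom (cl_family AA).
Proof.
have main (M : lmodType R) (alpha : {linear R^o -> M}) : fg_module M ->
    cl_phantom (cl_family AA) alpha ->
    cl_phantom (cl_family AA) (alpha_sym2 alpha).
  move=> fgM phantom.
  have [A AA_A [g g1]] := phantom_to_algebra noethR fgM phantom.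
  have gl y : linear (fun x => g x * g y).
    by move=> a x x'; rewrite linearP mulrDl /GRing.scale /= /alg_scale mulrA.
  have gr x : linear (fun y => g x * g y).
    by move=> a y y'; rewrite linearP mulrDr /GRing.scale /= /alg_scale mulrCA.
  have [G GE] := sym2_lift_exists gl gr (fun x y => mulrC (g x) (g y)).
  apply: (algebra_to_phantom (g := G) (alpha_sym2_inj fgM phantom.1) AA_A).
  by rewrite /= /scale_map scale1r GE g1 mulr1.
by split=> [M alpha fgM _|]; exact: main.
Qed.
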